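(* Let $F\in K[x]$ be a monic irreducible polynomial, and let $\nu\in\mathcal V\setminus\{\nu_0\}$ be a valuation that is not a maximal element of $(\mathcal V,\leq)$. Then $\nu\in\mathcal V_F$ if and only if $\mathrm{in}_\nu(F)\notin\mathcal U_\nu$.
   Context: $(K,\nu_0)$ is a valued field with value group $\Gamma_0$, and $\Gamma$ is a fixed totally ordered divisible abelian group containing $\Gamma_0$; $\Gamma_\infty=\Gamma\cup\{\infty\}$ with the usual conventions. A valuation on a commutative unital ring $R$ is a map $\nu:R\to\Gamma_\infty$ with $\nu(ab)=\nu(a)+\nu(b)$, $\nu(a+b)\geq\min\{\nu(a),\nu(b)\}$, $\nu(1)=0$, $\nu(0)=\infty$; nonzero elements may have value $\infty$. Its support is $\mathrm{supp}(\nu)=\{a\in R\mid\nu(a)=\infty\}$. $\mathcal V=\{\nu_0\}\cup\{\nu:K[x]\to\Gamma_\infty\mid \nu\text{ is a valuation extending }\nu_0\}$, partially ordered by: $\nu_0\leq\nu$ for all $\nu\in\mathcal V$, and for $\nu,\mu\in\mathcal V\setminus\{\nu_0\}$, $\nu\leq\mu$ iff $\nu(f)\leq\mu(f)$ for every $f\in K[x]$. For a monic irreducible $F\in K[x]$: $\mathcal V_{F_\infty}=\{\mu\in\mathcal V\mid\mathrm{supp}(\mu)=(F)\}$ and $\mathcal V_F=\{\nu\in\mathcal V\mid\nu\leq\mu\text{ for some }\mu\in\mathcal V_{F_\infty}\}$. For $\nu\in\mathcal V\setminus\{\nu_0\}$, the graded ring is $\mathcal G_\nu=\bigoplus_{\gamma\in\nu(K[x]),\,\gamma<\infty}\mathcal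 P_\gamma/\mathcal P_\gamma^+$, where $\mathcal P_\gamma=\{a\in K[x]\mid\nu(a)\geq\gamma\}$ and $\mathcal P_\gamma^+=\{a\in K[x]\mid\nu(a)>\gamma\}$, with multiplication induced by that of $K[x]$ (it is an integral domain). $\mathcal U_\nu$ is the set of units of $\mathcal G_\nu$. For $a\notin\mathrm{supp}(\nu)$, $\mathrm{in}_\nu(a)$ is the image of $a$ in $\mathcal P_{\nu(a)}/\mathcal P_{\nu(a)}^+\subseteq\mathcal G_\nu$; for $a\in\mathrm{supp}(\nu)$, $\mathrm{in}_\nu(a)=0$. *)

(* Defs.v *)
From HB Require Import structures.
From mathcomp Require Import all_boot all_order all_algebra.
From mathcomp Require Import finmap generic_quotient ring_quotient.
From mathcomp Require Import boolp classical_sets cardinality.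

Set Implicit Arguments.
Unset Strict Implicit.
Unset Printing Implicit Defensive.

Import Order.TTheory GRing.Theory Num.Theory.
Local Open Scope ring_scope.
Local Open Scope quotient_scope.

(* Totality is a field of the mixin rather than inherited from Order.Total:
   HB refuses a structure joining Order.Total and GRing.Zmodule that is not
   below Num.RealDomain. *)
HB.mixin Record isOrderedGroup G of Num.POrderedZmodule G := {
  ogroup_total : total (<=%O : rel G);
  ogroup_lerD2l : forall x y z : G, x <= y -> z + x <= z + y
}.

HB.mixin Record isDivisibleGroup G of GRing.Zmodule G := {
  group_divisible : forall (n : nat) (x : G), (0 < n)%N -> exists y, y *+ n = x
}.

#[short(type="divOrderedGroupType")]
HB.structure Definition DivOrderedGroup :=
  { G of Num.POrderedZmodule G & isOrderedGroup G & isDivisibleGroup G }.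

Section OrderedGroupTheory.
Variable G : divOrderedGroupType.
Implicit Types x y z : G.

Lemma oltNge x y : (x < y) = ~~ (y <= x).
Proof. by rewrite -comparable_ltNge // /Order.comparable ogroup_total. Qed.

Lemma oleD2l z x y : (z + x <= z + y) = (x <= y).
Proof.
apply/idP/idP; last exact: ogroup_lerD2l.
by move/(@ogroup_lerD2l G _ _ (- z)); rewrite !addKr.
Qed.

Lemma oleD2r z x y : (x + z <= y + z) = (x <= y).
Proof. by rewrite ![_ + z]addrC oleD2l. Qed.

Lemma oltD2l z x y : (z + x < z + y) = (x < y).
Proof. by rewrite !oltNge oleD2l. Qed.

Lemma oltD2r z x y : (x + z < y + z) = (x < y).
Proof. by rewrite !oltNge oleD2r. Qed.

Lemma oleD x y z t : x <= y -> z <= t -> x + z <= y + t.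
Proof. by move=> xy zt; apply: (@le_trans _ _ (y + z)); rewrite ?oleD2r ?oleD2l. Qed.

Lemma ltr_leD x y z t : x < y -> z <= t -> x + z < y + t.
Proof. by move=> xy zt; apply: (@lt_le_trans _ _ (y + z)); rewrite ?oltD2r ?oleD2l. Qed.

Lemma oaddrr_eq0 x : x + x = 0 -> x = 0.
Proof.
move=> xx0; case: (comparable_ltgtP (ogroup_total x 0)) => // x0.
- by have := ltr_leD x0 (ltW x0); rewrite xx0 addr0 ltxx.
- by have := ltr_leD x0 (ltW x0); rewrite xx0 addr0 ltxx.
Qed.

End OrderedGroupTheory.

(* [Gamma_oo G] is the group G with a greatest, absorbing element added;
   that element is [infty], and [fin g] is g. *)
Definition Gamma_oo (G : Type) : Type := option G.
Definition fin (G : Type) (g : G) : Gamma_oo G := Some g.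
Definition infty (G : Type) : Gamma_oo G := None.
Arguments infty {G}.

Section GammaInfinity.
Variable G : divOrderedGroupType.
Implicit Types u v w : Gamma_oo G.

HB.instance Definition _ := Choice.copy (Gamma_oo G) (option G).

Definition oo_le u v : bool :=
  match u, v with
  | _, None => true
  | None, Some _ => false
  | Some g, Some h => g <= h
  end.

Lemma oo_le_refl : reflexive oo_le. Proof. by case=> /=. Qed.
Lemma oo_le_anti : antisymmetric oo_le.
Proof. by move=> [x|] [y|] //= /le_anti ->. Qed.
Lemma oo_le_trans : transitive oo_le.
Proof. by move=> [y|] [x|] [z|] //=; apply: le_trans. Qed.
Lemma oo_le_total : total oo_le.
Proof. by move=> [x|] [y|] //=; apply: ogroup_total. Qed.

HB.instance Definition _ := Order.Le_isPOrder.Build ring_display (Gamma_oo G)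
  oo_le_refl oo_le_anti oo_le_trans.
HB.instance Definition _ :=
  Order.POrder_isTotal.Build ring_display (Gamma_oo G) oo_le_total.

Definition oo_add u v : Gamma_oo G :=
  match u, v with
  | Some g, Some h => fin (g + h)
  | _, _ => infty
  end.

Lemma oo_addA : associative oo_add.
Proof. by move=> [x|] [y|] [z|] //=; rewrite /fin addrA. Qed.
Lemma oo_addC : commutative oo_add.
Proof. by move=> [x|] [y|] //=; rewrite addrC. Qed.
Lemma oo_add0 : left_id (fin 0) oo_add.
Proof. by move=> [x|] //=; rewrite add0r. Qed.

HB.instance Definition _ :=
  GRing.isNmodule.Build (Gamma_oo G) oo_addA oo_addC oo_add0.

Lemma oo_le_fin (g h : G) : (fin g <= fin h) = (g <= h). Proof. by []. Qed.
Lemma oo_le_infty u : u <= infty. Proof. by case: u. Qed.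
Lemma oo_infty_le u : (infty <= u) = (u == infty). Proof. by case: u. Qed.
Lemma oo_lt_fin (g h : G) : (fin g < fin h) = (g < h).
Proof. by rewrite ltNge oltNge oo_le_fin. Qed.
Lemma oo_fin_infty (g : G) : fin g < infty.
Proof. by rewrite ltNge oo_infty_le. Qed.
Lemma oo_addfin (g h : G) : fin g + fin h = fin (g + h). Proof. by []. Qed.
Lemma oo_addinfty u : u + infty = infty. Proof. by case: u. Qed.

Lemma oo_leD u v w t : u <= v -> w <= t -> u + w <= v + t.
Proof.
by case: u v w t => [x|] [y|] [z|] [t|] //=; rewrite /Order.le /=; apply: oleD.
Qed.

Lemma oo_lt_leD (g h : G) v t : fin g < v -> fin h <= t -> fin (g + h) < v + t.
Proof.
case: v t => [y|] [t|] //=; rewrite ?oo_addinfty //.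
by rewrite oo_addfin !oo_lt_fin oo_le_fin; apply: ltr_leD.
Qed.

End GammaInfinity.

Record valuation (G : divOrderedGroupType) (R : comNzRingType) := Valuation {
  val_fun :> R -> Gamma_oo G;
  valM : forall a b, val_fun (a * b) = val_fun a + val_fun b;
  valD : forall a b, Order.min (val_fun a) (val_fun b) <= val_fun (a + b);
  val1 : val_fun 1 = fin 0;
  val0 : val_fun 0 = infty
}.

Definition supp G R (nu : valuation G R) : set R := [set a | nu a = infty].

Section ValuationTheory.
Variables (G : divOrderedGroupType) (R : comNzRingType) (nu : valuation G R).

Lemma valN a : nu (- a) = nu a.
Proof.
suff h : nu (-1) = fin 0 by rewrite -mulN1r valM h add0r.
have := valM nu (-1) (-1); rewrite mulrNN mulr1 val1.
case: (nu (-1)) => [g|//]; rewrite oo_addfin => -[/esym g0].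
by rewrite (oaddrr_eq0 g0).
Qed.

Lemma valB_ge u a b : u <= nu a -> u <= nu b -> u <= nu (a - b).
Proof.
by move=> ua ub; apply: le_trans (valD nu a (- b)); rewrite le_min ua valN.
Qed.

Lemma valB_gt u a b : u < nu a -> u < nu b -> u < nu (a - b).
Proof.
by move=> ua ub; apply: lt_le_trans (valD nu a (- b)); rewrite lt_min ua valN.
Qed.

End ValuationTheory.

(* P_g as a subset of R; Pge_type g is the corresponding additive group. *)
Definition Pge G R (nu : valuation G R) (g : G) : {pred R} :=
  fun a => fin g <= nu a.

Section Pieces.
Variables (G : divOrderedGroupType) (R : comNzRingType) (nu : valuation G R).
Implicit Types g h c : G.

Lemma Pge_zmod g : zmod_closed (Pge nu g).
Proof.
split; first by rewrite /Pge unfold_in val0.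
by move=> a b; rewrite /Pge !unfold_in; apply: valB_ge.
Qed.
HB.instance Definition _ g := GRing.isZmodClosed.Build R (Pge nu g) (Pge_zmod g).

Definition Pge_type g : Type := {a : R | a \in Pge nu g}.
HB.instance Definition _ g := SubChoice.on (Pge_type g).
HB.instance Definition _ g := [SubChoice_isSubZmodule of Pge_type g by <:].

(* P_g^+ as a subgroup of P_g *)
Definition Pgt g : {pred Pge_type g} := fun a => fin g < nu (val a).

Arguments Pgt g : clear implicits.

Lemma Pgt_zmod g : zmod_closed (Pgt g).
Proof.
split; first by rewrite /Pgt unfold_in raddf0 val0 oo_fin_infty.
by move=> a b; rewrite /Pgt !unfold_in raddfB; apply: valB_gt.
Qed.
HB.instance Definition _ g :=
  GRing.isZmodClosed.Build (Pge_type g) (Pgt g) (Pgt_zmod g).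

Definition gr_piece g : zmodType := Quotient.quot (Pgt g).

(* The class of r in P_g / P_g^+; only meaningful when r is in P_g. *)
Definition cls g (r : R) : gr_piece g :=
  \pi_(Quotient.quot (Pgt g)) (insubd (0 : Pge_type g) r).

Definition rep g (x : gr_piece g) : R := val (repr (x : Quotient.quot (Pgt g))).

Lemma rep_ge g (x : gr_piece g) : fin g <= nu (rep x).
Proof. exact: (valP (repr (x : Quotient.quot (Pgt g)))). Qed.

Lemma repK g (x : gr_piece g) : cls g (rep x) = x.
Proof. by rewrite /cls /rep valKd reprK. Qed.

Lemma val_insubd_Pge g r : fin g <= nu r ->
  val (insubd (0 : Pge_type g) r) = r.
Proof. by move=> gr; rewrite val_insubd unfold_in /Pge gr. Qed.

Lemma cls_eqP g r s : fin g <= nu r -> fin g <= nu s ->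
  cls g r = cls g s <-> fin g < nu (r - s).
Proof.
move=> gr gs; rewrite /cls; split.
  move/eqP; rewrite -Quotient.idealrBE unfold_in /Pgt raddfB /=.
  by rewrite !val_insubd_Pge.
move=> h; apply/eqP; rewrite -Quotient.idealrBE unfold_in /Pgt raddfB /=.
by rewrite !val_insubd_Pge.
Qed.

Lemma clsD g r s : fin g <= nu r -> fin g <= nu s ->
  cls g (r + s) = cls g r + cls g s.
Proof.
move=> gr gs; rewrite /cls /= -[RHS]raddfD; congr (\pi _).
have gD : fin g <= nu (r + s) by apply: le_trans (valD nu r s); rewrite le_min gr.
by apply: val_inj; rewrite raddfD /= !val_insubd_Pge.
Qed.

Lemma cls0 g : cls g 0 = 0.
Proof.
rewrite /cls; have -> : insubd (0 : Pge_type g) 0 = 0.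
  by apply: val_inj; rewrite val_insubd_Pge ?val0 ?oo_le_infty // raddf0.
exact: raddf0.
Qed.

Lemma cls_eq0 g r : fin g < nu r -> cls g r = 0.
Proof.
move=> gr; rewrite -(cls0 g); apply/cls_eqP; rewrite ?val0 ?oo_le_infty ?ltW //.
by rewrite subr0.
Qed.

Lemma gr_piece_trivial g (x : gr_piece g) : (forall a, nu a != fin g) -> x = 0.
Proof.
by move=> h; rewrite -(repK x) cls_eq0 // lt_neqAle rep_ge andbT eq_sym h.
Qed.

(* The product P_g/P_g^+ x P_h/P_h^+ -> P_c/P_c^+ induced by that of R; only
   meaningful when c = g + h. *)
Definition piece_mul g h c (x : gr_piece g) (y : gr_piece h) : gr_piece c :=
  cls c (rep x * rep y).

Lemma piece_mul_cls g h r s : fin g <= nu r -> fin h <= nu s ->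
  piece_mul (g + h) (cls g r) (cls h s) = cls (g + h) (r * s).
Proof.
move=> gr hs.
have er : fin g < nu (rep (cls g r) - r) by apply/cls_eqP; rewrite ?rep_ge ?repK.
have es : fin h < nu (rep (cls h s) - s) by apply/cls_eqP; rewrite ?rep_ge ?repK.
apply/cls_eqP; rewrite ?valM -?oo_addfin; do ?by apply: oo_leD; rewrite ?rep_ge.
set r' := rep _; set s' := rep _.
have -> : r' * s' - r * s = (r' - r) * s' - r * (s - s').
  by rewrite mulrBl mulrBr opprB addrA subrK.
apply: valB_gt; rewrite valM; first by apply: oo_lt_leD; rewrite ?rep_ge.
by rewrite oo_addfin [nu _ + _]addrC [g + h]addrC; apply: oo_lt_leD => //; rewrite -valN opprB.
Qed.

Lemma piece_mulC g h c (x : gr_piece g) (y : gr_piece h) :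
  piece_mul c x y = piece_mul c y x.
Proof. by rewrite /piece_mul mulrC. Qed.

Lemma piece_mulDl g h (x x' : gr_piece g) (y : gr_piece h) :
  piece_mul (g + h) (x + x') y = piece_mul (g + h) x y + piece_mul (g + h) x' y.
Proof.
rewrite -(repK x) -(repK x') -(repK y).
have ge3 := (rep_ge x, rep_ge x', rep_ge y).
have geD : fin g <= nu (rep x + rep x').
  by apply: le_trans (valD nu _ _); rewrite le_min !ge3.
rewrite -clsD ?ge3 // !piece_mul_cls ?ge3 // mulrDl clsD //.
- by rewrite valM -(oo_addfin); apply: oo_leD; rewrite ge3.
- by rewrite valM -(oo_addfin); apply: oo_leD; rewrite ge3.
Qed.

Lemma piece_mulDr g h (x : gr_piece g) (y y' : gr_piece h) :
  piece_mul (g + h) x (y + y') = piece_mul (g + h) x y + piece_mul (g + h) x y'.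
Proof. by rewrite ![piece_mul _ x _]piece_mulC ![g + h]addrC piece_mulDl. Qed.

Lemma piece_mul0l g h (y : gr_piece h) : piece_mul (g + h) (0 : gr_piece g) y = 0.
Proof.
by apply: (addIr (piece_mul (g + h) (0 : gr_piece g) y)); rewrite -piece_mulDl !add0r.
Qed.

Lemma piece_mul0r g h (x : gr_piece g) : piece_mul (g + h) x (0 : gr_piece h) = 0.
Proof. by rewrite piece_mulC addrC piece_mul0l. Qed.

Lemma piece_mulA g h k (x : gr_piece g) (y : gr_piece h) (z : gr_piece k) :
  piece_mul (g + h + k) (piece_mul (g + h) x y) z =
  piece_mul (g + h + k) x (piece_mul (h + k) y z).
Proof.
have ge3 := (rep_ge x, rep_ge y, rep_ge z).
rewrite -(repK x) -(repK y) -(repK z) !piece_mul_cls ?ge3 //; last first.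
  by rewrite valM -(oo_addfin); apply: oo_leD; rewrite ge3.
rewrite -addrA piece_mul_cls ?ge3 ?mulrA //.
by rewrite valM -(oo_addfin); apply: oo_leD; rewrite ge3.
Qed.

End Pieces.

Section GradedRing.
Variables (G : divOrderedGroupType) (R : comNzRingType) (nu : valuation G R).
Implicit Types g h c : G.

Local Open Scope classical_set_scope.

(* The direct sum of the pieces P_g / P_g^+ over all g in G; by
   gr_piece_trivial only the values of nu contribute. *)
Record graded_ring := Graded {
  gr_coef :> forall g : G, gr_piece nu g;
  gr_finite : finite_set [set g | gr_coef g != 0]
}.

HB.instance Definition _ := gen_eqMixin graded_ring.
HB.instance Definition _ := gen_choiceMixin graded_ring.

Implicit Types x y z : graded_ring.

Lemma gr_eqP x y : (forall g, x g = y g) -> x = y.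
Proof.
case: x y => [x xP] [y yP] /= xy.
have {}xy : x = y by apply: functional_extensionality_dep.
by case: y / xy yP => yP; congr Graded; apply: Prop_irrelevance.
Qed.

Lemma gr0_finite : finite_set [set g | (0 : gr_piece nu g) != 0].
Proof.
rewrite (_ : [set g | _] = set0); first exact: finite_set0.
by apply/seteqP; split=> g //=; rewrite eqxx.
Qed.

Lemma grN_finite x : finite_set [set g | - x g != 0].
Proof.
by apply: sub_finite_set (gr_finite x) => g /=; rewrite oppr_eq0.
Qed.

Lemma grD_finite x y : finite_set [set g | x g + y g != 0].
Proof.
apply: (@sub_finite_set _ _ ([set g | x g != 0] `|` [set g | y g != 0])).
  move=> g /=; case: (eqVneq (x g) 0) => [->|]; last by left.
  by rewrite add0r; right.
by rewrite finite_setU; split; apply: gr_finite.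
Qed.

Definition gr_zero := Graded gr0_finite.
Definition gr_opp x := Graded (grN_finite x).
Definition gr_add x y := Graded (grD_finite x y).

Lemma gr_addA : associative gr_add.
Proof. by move=> x y z; apply: gr_eqP => g /=; rewrite addrA. Qed.
Lemma gr_addC : commutative gr_add.
Proof. by move=> x y; apply: gr_eqP => g /=; rewrite addrC. Qed.
Lemma gr_add0 : left_id gr_zero gr_add.
Proof. by move=> x; apply: gr_eqP => g /=; rewrite add0r. Qed.
Lemma gr_addN : left_inverse gr_zero gr_opp gr_add.
Proof. by move=> x; apply: gr_eqP => g /=; rewrite addNr. Qed.

HB.instance Definition _ :=
  GRing.isZmodule.Build graded_ring gr_addA gr_addC gr_add0 gr_addN.

Lemma gr_coefD x y g : (x + y) g = x g + y g. Proof. by []. Qed.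
Lemma gr_coef0 g : (0 : graded_ring) g = 0. Proof. by []. Qed.

Fact gr_supp_exists x : {s : seq G | uniq s & forall g, (g \in s) = (x g != 0)}.
Proof.
exists (fset_set [set g | x g != 0]); first exact: fset_uniq.
by move=> g; rewrite in_fset_set ?mem_setE //; exact: gr_finite.
Qed.

Definition gr_supp x : seq G := s2val (gr_supp_exists x).

Lemma gr_suppP x g : (g \in gr_supp x) = (x g != 0).
Proof. exact: (s2valP' (gr_supp_exists x)). Qed.

Lemma gr_supp_uniq x : uniq (gr_supp x).
Proof. exact: (s2valP (gr_supp_exists x)). Qed.

Definition gr_mul_coef x y c : gr_piece nu c :=
  \sum_(g <- gr_supp x) \sum_(h <- gr_supp y | g + h == c)
    piece_mul c (x g) (y h).

Lemma gr_mul_finite x y : finite_set [set c | gr_mul_coef x y c != 0].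
Proof.
apply: (@sub_finite_set _ _
  [set` [seq g + h | g <- gr_supp x, h <- gr_supp y]]); last exact: finite_seq.
move=> c /= nz; apply: contraNT nz => cN; apply/eqP.
rewrite /gr_mul_coef big_seq big1 // => g gx.
rewrite big_seq_cond big1 // => h /andP[hy /eqP e].
by rewrite -e allpairs_f in cN.
Qed.

Definition gr_mul x y := Graded (gr_mul_finite x y).

(* The supports may be replaced by any duplicate-free lists containing them. *)
Lemma gr_mulE (s t : seq G) x y c : uniq s -> uniq t ->
  {subset gr_supp x <= s} -> {subset gr_supp y <= t} ->
  gr_mul x y c = \sum_(g <- s) \sum_(h <- t | g + h == c) piece_mul c (x g) (y h).
Proof.
move=> us ut xs yt /=; rewrite /gr_mul_coef.
pose f g := \sum_(h <- t | g + h == c) piece_mul c (x g) (y h).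
rewrite -[RHS]/(\sum_(g <- s) f g) [RHS](bigID (fun g => x g != 0)) /= [X in _ + X]big1 ?addr0; last first.
  by move=> g /negPn/eqP xg; rewrite /f big1 // => h /eqP <-; rewrite xg piece_mul0l.
rewrite -[RHS]big_filter.
have -> : \sum_(i <- [seq i <- s | x i != 0]) f i = \sum_(i <- gr_supp x) f i.
  apply: perm_big; apply: uniq_perm; rewrite ?filter_uniq ?gr_supp_uniq // => g.
  rewrite mem_filter gr_suppP; case: eqVneq => //= xg; apply: xs.
  by rewrite gr_suppP.
apply: eq_bigr => g _; rewrite /f.
rewrite [RHS](bigID (fun h => y h != 0)) /= [X in _ + X]big1 ?addr0; last first.
  by move=> h /andP[/eqP <- /negPn/eqP yh]; rewrite yh piece_mul0r.
under [RHS]eq_bigl => h do rewrite andbC.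
rewrite -big_filter_cond; apply: perm_big.
apply: uniq_perm; rewrite ?filter_uniq ?gr_supp_uniq // => h.
rewrite mem_filter gr_suppP; case: eqVneq => //= yh; apply/esym/yt.
by rewrite gr_suppP.
Qed.

Lemma gr_supp_mul x y :
  {subset gr_supp (gr_mul x y) <= undup [seq g + h | g <- gr_supp x, h <- gr_supp y]}.
Proof.
move=> c; rewrite gr_suppP mem_undup; apply: contraNT => cN; apply/eqP => /=.
rewrite /gr_mul_coef big_seq big1 // => g gx.
rewrite big_seq_cond big1 // => h /andP[hy /eqP e].
by rewrite -e allpairs_f in cN.
Qed.

Lemma gr_mulC : commutative gr_mul.
Proof.
move=> x y; apply: gr_eqP => c /=; rewrite /gr_mul_coef.
rewrite (exchange_big_dep xpredT) //=; apply: eq_bigr => h _.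
by apply: eq_big => [g|g _]; rewrite 1?addrC // piece_mulC.
Qed.

Lemma sum_only1 (V : zmodType) (s : seq G) (P : pred G) d (F : G -> V) :
  uniq s -> d \in s -> P =1 pred1 d -> \sum_(i <- s | P i) F i = F d.
Proof.
move=> us ds Pd; rewrite (eq_bigl _ _ Pd) big_mkcond (bigD1_seq d) //= eqxx.
by rewrite big1 ?addr0 // => i /negPf ->.
Qed.

Lemma cover3 (s1 s2 s3 : seq G) : exists s, [/\ uniq s, {subset s1 <= s},
  {subset s2 <= s} & {subset s3 <= s}].
Proof.
exists (undup (s1 ++ s2 ++ s3)); split; first exact: undup_uniq.
- by move=> g gs; rewrite mem_undup !mem_cat gs.
- by move=> g gs; rewrite mem_undup !mem_cat gs orbT.
- by move=> g gs; rewrite mem_undup !mem_cat gs !orbT.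
Qed.

Lemma gr_mulDl : left_distributive gr_mul +%R.
Proof.
move=> x y z; apply: gr_eqP => c; rewrite gr_coefD.
have [s [us xs ys xys]] := cover3 (gr_supp x) (gr_supp y) (gr_supp (x + y)).
have uz := gr_supp_uniq z.
have zz : {subset gr_supp z <= gr_supp z} := fun g gz => gz.
rewrite (gr_mulE _ us uz xs zz) (gr_mulE _ us uz ys zz) (gr_mulE _ us uz xys zz).
rewrite -big_split /=; apply: eq_bigr => g _.
by rewrite -big_split /=; apply: eq_bigr => h /eqP <-; rewrite piece_mulDl.
Qed.

Lemma piece_mul_suml (I : Type) (s : seq I) (P : pred I) g h c
    (F : I -> gr_piece nu g) (y : gr_piece nu h) : g + h = c ->
  piece_mul c (\sum_(i <- s | P i) F i) y = \sum_(i <- s | P i) piece_mul c (F i) y.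
Proof.
move=> <-; apply: (big_morph (fun u => piece_mul (g + h) u y)) => [u v|].
  exact: piece_mulDl.
exact: piece_mul0l.
Qed.

Lemma gr_mul_mul x y z c : gr_mul (gr_mul x y) z c =
  \sum_(g <- gr_supp x) \sum_(h <- gr_supp y) \sum_(k <- gr_supp z | g + h + k == c)
    piece_mul c (piece_mul (g + h) (x g) (y h)) (z k).
Proof.
pose s := undup [seq g + h | g <- gr_supp x, h <- gr_supp y].
rewrite (@gr_mulE s (gr_supp z) (gr_mul x y) z c (undup_uniq _) (gr_supp_uniq z) (@gr_supp_mul x y)) //.
transitivity (\sum_(d <- s) \sum_(g <- gr_supp x) \sum_(h <- gr_supp y | g + h == d)
    \sum_(k <- gr_supp z | d + k == c)
    piece_mul c (piece_mul d (x g) (y h)) (z k)).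
  apply: eq_bigr => d _.
  transitivity (\sum_(k <- gr_supp z | d + k == c) \sum_(g <- gr_supp x)
     \sum_(h <- gr_supp y | g + h == d) piece_mul c (piece_mul d (x g) (y h)) (z k)).
    apply: eq_bigr => k /eqP dk; rewrite /= /gr_mul_coef piece_mul_suml //.
    by apply: eq_bigr => g _; rewrite piece_mul_suml.
  rewrite exchange_big; apply: eq_bigr => g _; exact: exchange_big.
rewrite exchange_big /= big_seq [RHS]big_seq; apply: eq_bigr => g gx.
rewrite (exchange_big_dep xpredT) //= big_seq [RHS]big_seq; apply: eq_bigr => h hy.
apply: sum_only1; first exact: undup_uniq.
  by rewrite mem_undup allpairs_f.
by move=> d /=; rewrite eq_sym.
Qed.

Lemma gr_mulA : associative gr_mul.
Proof.
move=> x y z; apply: gr_eqP => c; rewrite [gr_mul x _]gr_mulC !gr_mul_mul.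
rewrite [RHS]exchange_big; apply: eq_bigr => h _.
rewrite (exchange_big_dep xpredT) //; apply: eq_bigr => g _.
have e k : h + k + g = g + h + k by rewrite addrC addrA.
apply: eq_big => [k|k]; first by rewrite e.
by rewrite e => /eqP <-; rewrite [RHS]piece_mulA piece_mulC.
Qed.

(* The element of G_nu whose only component is the class of r, in degree d. *)
Definition gr_hom_coef d (r : R) : forall g, gr_piece nu g :=
  fun g => if g == d then cls nu g r else 0.

Lemma gr_hom_finite d r : finite_set [set g | gr_hom_coef d r g != 0].
Proof.
apply: sub_finite_set (finite_set1 d) => g /=; rewrite /gr_hom_coef.
by case: (eqVneq g d) => [-> //|_]; rewrite eqxx.
Qed.

Definition gr_hom d r := Graded (gr_hom_finite d r).

Lemma gr_mul1 : left_id (gr_hom 0 1) gr_mul.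
Proof.
move=> x; apply: gr_eqP => c.
rewrite (@gr_mulE [:: 0] (gr_supp x)) ?gr_supp_uniq //; last first.
  by move=> g; rewrite gr_suppP /= /gr_hom_coef inE; case: (eqVneq g 0) => // _; rewrite eqxx.
rewrite big_seq1 /= /gr_hom_coef eqxx.
have mul1 h (u : gr_piece nu h) : piece_mul h (cls nu 0 1) u = u.
  have := @piece_mul_cls G R nu 0 h 1 (rep u).
  by rewrite add0r mul1r val1 repK; apply; rewrite ?rep_ge.
under eq_bigl do rewrite add0r.
rewrite -big_filter.
have [xc|xc] := boolP (c \in gr_supp x).
  by rewrite big_filter (@sum_only1 _ _ _ c) ?gr_supp_uniq // mul1.
rewrite big_filter big_seq_cond big1; first by move: xc; rewrite gr_suppP negbK => /eqP.
by move=> h /andP[hx /eqP hc]; case/negP: xc; rewrite -hc.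
Qed.

Lemma gr_1neq0 : gr_hom 0 1 != 0.
Proof.
apply/eqP => /(congr1 (fun x : graded_ring => x 0)) /=.
rewrite /gr_hom_coef eqxx -(cls0 nu 0) => /cls_eqP.
by rewrite val1 val0 oo_le_infty subr0 val1 ltxx => /(_ _ _)/negP; case.
Qed.

HB.instance Definition _ := GRing.Zmodule_isComNzRing.Build graded_ring
  gr_mulA gr_mulC gr_mul1 gr_mulDl gr_1neq0.

Definition gr_unit : {pred graded_ring} :=
  fun x => `[< exists y : graded_ring, y * x = 1 >].

Definition gr_inv x : graded_ring :=
  if pselect (exists y : graded_ring, y * x = 1) is left e then sval (cid e) else x.

Lemma gr_mulV : {in gr_unit, left_inverse 1 gr_inv *%R}.
Proof.
move=> x; rewrite unfold_in /gr_inv => /asboolP ux.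
by case: pselect => // e; case: (cid e).
Qed.

Lemma gr_unitPl x y : y * x = 1 -> gr_unit x.
Proof. by move=> yx; apply/asboolP; exists y. Qed.

Lemma gr_inv_out : {in [predC gr_unit], gr_inv =1 id}.
Proof.
move=> x; rewrite inE unfold_in /gr_inv => /asboolP nux.
by case: pselect.
Qed.

HB.instance Definition _ := GRing.ComNzRing_hasMulInverse.Build graded_ring
  gr_mulV gr_unitPl gr_inv_out.

Definition initial (a : R) : graded_ring :=
  if nu a is Some g then gr_hom g a else 0.

End GradedRing.

Arguments graded_ring {G R} nu.
Arguments initial {G R} nu a.

Section ValuationPoset.
Variables (G : divOrderedGroupType) (K : fieldType) (nu0 : valuation G K).

Record ext_valuation := ExtValuation {
  ext_val :> valuation G {poly K};
  ext_valC : forall c : K, ext_val c%:P = nu0 c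
}.

Lemma ext_valuation_eq (nu mu : ext_valuation) :
  (forall f, nu f = mu f) -> nu = mu.
Proof.
case: nu mu => [[n n1 n2 n3 n4] nC] [[m m1 m2 m3 m4] mC] /= nm.
have {}nm : n = m by apply: functional_extensionality_dep.
case: m / nm in m1 m2 m3 m4 mC *.
rewrite (Prop_irrelevance m1 n1) (Prop_irrelevance m2 n2) in mC *.
rewrite (Prop_irrelevance m3 n3) (Prop_irrelevance m4 n4) in mC *.
by rewrite (Prop_irrelevance mC nC).
Qed.

Inductive valuations := Base | Ext of ext_valuation.

HB.instance Definition _ := gen_eqMixin valuations.
HB.instance Definition _ := gen_choiceMixin valuations.

(* Base stands for nu0, the least element. *)
Definition vle (u v : valuations) : bool :=
  match u, v with
  | Base, _ => true
  | Ext _, Base => false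
  | Ext nu, Ext mu => `[< forall f : {poly K}, nu f <= mu f >]
  end.

Lemma vle_refl : reflexive vle.
Proof. by case=> //= nu; apply/asboolP. Qed.
Lemma vle_anti : antisymmetric vle.
Proof.
move=> [|nu] [|mu] //= /andP[/asboolP nm /asboolP mn]; congr Ext.
by apply: ext_valuation_eq => f; apply: le_anti; rewrite nm mn.
Qed.
Lemma vle_trans : transitive vle.
Proof.
move=> [|mu] [|nu] [|la] //= /asboolP nm /asboolP ml.
by apply/asboolP => f; apply: le_trans (ml f).
Qed.

Fact valuations_display : Order.disp_t. Proof. exact. Qed.

HB.instance Definition _ := Order.Le_isPOrder.Build valuations_display valuations
  vle_refl vle_anti vle_trans.

Local Open Scope classical_set_scope.

Definition is_maximal (v : valuations) : Prop :=
  forall w : valuations, (v <= w)%O -> w = v.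

Definition V_infty (F : {poly K}) : set valuations :=
  [set v | exists2 mu, v = Ext mu & supp mu = range (fun a : {poly K} => a * F)].

Definition V_below (F : {poly K}) : set valuations :=
  [set v | exists2 w, V_infty F w & (v <= w)%O].

End ValuationPoset.

(* Main.v *)
Require Import Defs.
From mathcomp Require Import all_boot all_order all_algebra all_field.
From mathcomp Require Import ring.
From mathcomp Require Import boolp classical_sets.

Set Implicit Arguments.
Unset Strict Implicit.
Unset Printing Implicit Defensive.

Import Order.TTheory GRing.Theory Num.Theory.
Local Open Scope ring_scope.

(** Let [alpha] be a root of [F] in [L = K[x]/(F)].  A valuation of [K[x]]
extending [nu0] with support [(F)] is the same thing as a valuation [w] of [L] extending [nu0], read
through evaluation at [alpha]; so [nu] lies below one of them iff some such [w]
satisfies [nu f <= w (f alpha)] for all [f].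

The initial form of [F] is a unit iff [nu (a * F - 1) > 0] for some [a]
([initial_unitP]).  Such an [a] excludes any [mu >= nu] with support [(F)],
because [mu (a * F)] would be infinite while [mu (a * F - 1)] is positive,
giving [mu 1 > 0].

Conversely, let [B] be the image in [L] of the ring [nu >= 0] and [I] the image
of its ideal [nu > 0].  That no such [a] exists says exactly that [1] is not in
[I].  Chevalley's theorem ([chevalley]) then provides a valuation ring [O] of
[L] containing [B], with a proper ideal containing [I].  Since [O] lies above
the valuation ring of [nu0] and [L] is algebraic over [K], it is the ring of a
valuation [w] extending [nu0], whose values are torsion over those of [nu0] and
therefore exist in the divisible group [G] ([extend_valuation]).

This [w] automatically dominates [nu], although [nu] may take values outside
the divisible hull of the values of [nu0].  If [w (f alpha) < nu f], pick [n]
and [c] in [K] with [n * w (f alpha) = nu0 c]; then [f ^ n / c] has positive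
[nu], so its value at [alpha] is in the proper ideal, but that value is a unit
of [O] ([specialization_at_root]). *)

(** * Chevalley's theorem on valuation rings *)

Section Chevalley.
Local Open Scope classical_set_scope.
Variable L : fieldType.
Implicit Types (A B I M O : set L) (x y z : L).

Record is_subring B : Prop := IsSubring {
  subring1 : B 1;
  subringB : forall x y, B x -> B y -> B (x - y);
  subringM : forall x y, B x -> B y -> B (x * y)
}.

Record is_proper_ideal B I : Prop := ProperIdeal {
  ideal_sub : I `<=` B;
  ideal0 : I 0;
  idealD : forall x y, I x -> I y -> I (x + y);
  idealM : forall b x, B b -> I x -> I (b * x);
  ideal1 : ~ I 1
}.

Record valuation_ring O : Prop := ValuationRing {
  vring_subring :> is_subring O;
  vring_total : forall z, O z \/ O z^-1
}.

Lemma subring0 B : is_subring B -> B 0.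
Proof. by case=> B1 BB _; rewrite -(subrr 1); apply: BB. Qed.

Lemma subringN B x : is_subring B -> B x -> B (- x).
Proof.
by move=> sB Bx; rewrite -sub0r; apply: (subringB sB) => //; apply: subring0.
Qed.

Lemma subringD B x y : is_subring B -> B x -> B y -> B (x + y).
Proof.
by move=> sB Bx By; rewrite -[y]opprK; apply: (subringB sB) => //; apply: subringN.
Qed.

Lemma subringX B x n : is_subring B -> B x -> B (x ^+ n).
Proof.
move=> sB Bx; elim: n => [|n IH]; first exact: subring1 sB.
by rewrite exprS; apply: (subringM sB).
Qed.

Section Extension.
Variables B I : set L.
Hypotheses (sB : is_subring B) (idI : is_proper_ideal B I).

(** The candidates for the ideal of the valuation ring: the ring itself is not
part of the data, since it can be recovered as the set of multipliers. *)
Record admissible A : Prop := Admissible {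
  adm_sub : I `<=` A;
  admD : forall x y, A x -> A y -> A (x + y);
  admM : forall x y, A x -> A y -> A (x * y);
  admZ : forall b x, B b -> A x -> A (b * x);
  adm1 : ~ A 1
}.

Lemma admissible_ideal : admissible I.
Proof.
case: idI => IB I0 ID IM I1; split=> // x y Ix Iy.
by apply: IM => //; apply: IB.
Qed.

Lemma adm0 A : admissible A -> A 0.
Proof. by move=> aA; apply: (adm_sub aA); apply: ideal0 idI. Qed.

Lemma maximal_admissible_exists :
  exists2 M, admissible M & forall A, admissible A -> M `<=` A -> A `<=` M.
Proof.
(* The empty set is let in because it is the union of the empty chain. *)
have [|M [PM Mmax]] := @Zorn_bigcup L (fun A => A = set0 \/ admissible A).
  move=> F FP Ftot.
  have [[A0 FA0 aA0]|noadm] := pselect (exists2 A, F A & admissible A); last first.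
    left; rewrite bigcup0 // => A FA; case: (FP A FA) => // aA.
    by case: noadm; exists A.
  have FaP A x : F A -> A x -> admissible A.
    by move=> FA Ax; case: (FP A FA) => // A0'; rewrite A0' in Ax.
  have two x y : (\bigcup_(X in F) X) x -> (\bigcup_(X in F) X) y ->
      exists A, [/\ F A, admissible A, A x & A y].
    move=> [A FA Ax] [A' FA' A'y].
    have [sub|sub] := Ftot _ _ FA FA'.
      by exists A'; split; [|exact: FaP A'y|exact: sub|].
    by exists A; split; [|exact: FaP Ax| |exact: sub].
  right; split.
  - by move=> x Ix; exists A0 => //; apply: (adm_sub aA0).
  - by move=> x y Ux Uy; have [A [FA aA Ax Ay]] := two x y Ux Uy;
      exists A => //; apply: (admD aA).
  - by move=> x y Ux Uy; have [A [FA aA Ax Ay]] := two x y Ux Uy;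
      exists A => //; apply: (admM aA).
  - by move=> b x Bb [A FA Ax]; exists A => //; apply: (admZ (FaP A x FA Ax)).
  - by move=> [A FA A1]; apply: (adm1 (FaP A 1 FA A1)).
have aM : admissible M.
  case: PM => // M0; case: (Mmax I); last by right; apply: admissible_ideal.
  by rewrite M0; split=> // I0; apply: (I0 0); apply: ideal0 idI.
exists M => // A aA MA; apply: contrapT => nAM.
by case: (Mmax A); [split | right].
Qed.

Section Maximal.
Variable M : set L.
Hypotheses (aM : admissible M)
  (Mmax : forall A, admissible A -> M `<=` A -> A `<=` M).

Definition multipliers : set L := [set z | forall m, M m -> M (z * m)].

Lemma adm_sum (J : Type) (r : seq J) (P : pred J) (f : J -> L) :
  (forall i, P i -> M (f i)) -> M (\sum_(i <- r | P i) f i).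
Proof. by move=> Mf; apply: big_ind => //; [apply: adm0|apply: admD]. Qed.

Lemma admN x : M x -> M (- x).
Proof.
move=> Mx; rewrite -mulN1r; apply: (admZ aM) => //.
by apply: subringN (subring1 sB).
Qed.

Definition unit_combination z n := exists2 a : nat -> L,
  (forall i, M (a i)) & \sum_(i < n.+1) a i * z ^+ i = 1.

(** The polynomials in [z] over [M] form a set containing [M] and [z * M],
admissible unless it contains [1]; maximality of [M] decides. *)
Lemma unit_combination_of_not_multiplier z :
  ~ multipliers z -> exists n, unit_combination z n.
Proof.
move=> nOz; apply: contrapT => none; apply: nOz => m Mm.
pose A := [set p.[z] | p in [set p : {poly L} | forall i, M p`_i]].
have MA : M `<=` A.
  move=> x Mx; exists x%:P; last by rewrite hornerC.
  by move=> i; rewrite coefC; case: (i == 0)%N => //; apply: adm0.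
apply: (Mmax _ MA); last first.
  exists ('X * m%:P); last by rewrite hornerM hornerX hornerC.
  move=> i; rewrite coefXM; case: eqP => _; first exact: adm0.
  by rewrite coefC; case: eqP => _ //; apply: adm0.
split.
- by move=> x Ix; apply: MA; apply: (adm_sub aM).
- move=> _ _ [p Mp <-] [q Mq <-]; exists (p + q); last by rewrite hornerD.
  by move=> i; rewrite coefD; apply: (admD aM).
- move=> _ _ [p Mp <-] [q Mq <-]; exists (p * q); last by rewrite hornerM.
  by move=> i; rewrite coefM; apply: adm_sum => j _; apply: (admM aM).
- move=> b _ Bb [p Mp <-]; exists (b *: p); last by rewrite hornerZ.
  by move=> i; rewrite coefZ; apply: (admZ aM).
- move=> [p Mp p1]; apply: none; exists (size p).-1; exists (fun i => p`_i) => //.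
  rewrite prednK; first by rewrite -horner_coef.
  by rewrite size_poly_gt0; apply/eqP => p0; move: p1; rewrite p0 horner0;
    apply/eqP; rewrite eq_sym oner_eq0.
Qed.

(** Given [1 = sum a_i z^i] of degree [n + 1] and [1 = sum b_j z^-j] of degree at
most [n + 1], multiply the first by [1 - b_0] and replace its leading term using
the second, in the form [(1 - b_0) z^(n+1) = sum_(j > 0) b_j z^(n+1-j)]. *)
Lemma unit_combination_step z n k : z != 0 -> (k <= n.+1)%N ->
  unit_combination z n.+1 -> unit_combination z^-1 k -> unit_combination z n.
Proof.
move=> z0 kn [a Ma sa] [b0 Mb0 sb0].
pose b j := if (j < k.+1)%N then b0 j else 0.
have Mb j : M (b j) by rewrite /b; case: ifP => // _; apply: adm0.
have sb : \sum_(j < n.+2) b j * z^-1 ^+ j = 1.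
  rewrite -sb0 (big_ord_widen n.+2 (fun j => b0 j * z^-1 ^+ j)) // [RHS]big_mkcond.
  by apply: eq_bigr => j _; rewrite /b; case: ifP => // _; rewrite mul0r.
(* Multiply by [z ^+ n.+1] and reverse the order of the terms. *)
have {}sb : \sum_(i < n.+2) b (n.+1 - i)%N * z ^+ i = z ^+ n.+1.
  rewrite -[RHS]mulr1 -sb big_distrr /= (reindex_inj rev_ord_inj) /=.
  apply: eq_bigr => i _; rewrite subSS (subKn (ltn_ord i : (i <= n.+1)%N)).
  have -> : z ^+ n.+1 = z ^+ (n.+1 - i) * z ^+ i.
    by rewrite -exprD subnK // -ltnS.
  by rewrite exprVn; field; rewrite expf_neq0.
have {}sa : \sum_(i < n.+1) a i * z ^+ i = 1 - a n.+1 * z ^+ n.+1.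
  by apply/eqP; rewrite eq_sym subr_eq -sa big_ord_recr.
have {}sb : \sum_(i < n.+1) b (n.+1 - i)%N * z ^+ i = (1 - b 0%N) * z ^+ n.+1.
  move: sb; rewrite big_ord_recr /= subnn mulrBl mul1r => sb.
  by rewrite -{1}sb addrK.
exists (fun i => (if i == 0 then b 0 else 0) + (1 - b 0%N) * a i
                  + a n.+1 * b (n.+1 - i)%N) => [i|].
  apply: (admD aM); last by apply: (admM aM).
  apply: (admD aM); first by case: ifP => // _; apply: adm0.
  by rewrite mulrBl mul1r; apply: (admD aM) => //; apply: admN; apply: (admM aM).
transitivity (b 0%N + (1 - b 0%N) * (\sum_(i < n.+1) a i * z ^+ i)
  + a n.+1 * (\sum_(i < n.+1) b (n.+1 - i)%N * z ^+ i)); last by rewrite sa sb; ring.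
under eq_bigr do rewrite 2!mulrDl -!mulrA.
rewrite !big_split /= -!big_distrr /=; congr (_ + _ + _).
by rewrite big_ord_recl big1 ?mulr1 ?addr0 // => i _; rewrite mul0r.
Qed.

Lemma unit_combination0 z : ~ unit_combination z 0.
Proof.
move=> [a Ma]; rewrite big_ord1 expr0 mulr1 => a1.
by apply: (adm1 aM); rewrite -a1.
Qed.

(** Descent: the larger of the two degrees can be lowered until it reaches [0],
which would put [1] in [M]. *)
Lemma unit_combination_inv_absurd z n k : z != 0 ->
  unit_combination z n -> ~ unit_combination z^-1 k.
Proof.
move: {2}(n + k).+1 (ltnSn (n + k)) => s.
elim: s z n k => // s IH z n k; rewrite ltnS => les z0 un uk.
wlog kn : z n k les z0 un uk / (k <= n)%N.
  move=> H; have [kn|/ltnW nk] := leqP k n; first exact: (H z n k).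
  by apply: (H z^-1 k n); rewrite ?invr_eq0 ?invrK // addnC.
case: n les un kn => [|n] les un kn; first exact: unit_combination0 un.
exact: (IH z n k les z0 (unit_combination_step z0 kn un uk) uk).
Qed.

Lemma multipliers_valuation_ring : valuation_ring multipliers.
Proof.
split; first split.
- by move=> m Mm; rewrite mul1r.
- move=> x y Ox Oy m Mm; rewrite mulrBl.
  by apply: (admD aM); [apply: Ox | apply: admN; apply: Oy].
- by move=> x y Ox Oy m Mm; rewrite -mulrA; apply/Ox/Oy.
move=> z; apply: contrapT => /not_orP[nOz nOV].
have z0 : z != 0.
  by apply/eqP => z0; apply: nOz => m Mm; rewrite z0 mul0r; apply: adm0.
have [n un] := unit_combination_of_not_multiplier nOz.
have [k uk] := unit_combination_of_not_multiplier nOV.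
exact: unit_combination_inv_absurd z0 un uk.
Qed.

Lemma maximal_admissible_ideal : is_proper_ideal multipliers M.
Proof.
split.
- by move=> x Mx m Mm; apply: (admM aM).
- exact: adm0.
- exact: admD aM.
- by move=> b x Ob Mx; apply: Ob.
- exact: adm1 aM.
Qed.

End Maximal.

(** A subring of a field with a proper ideal is dominated by a valuation ring: a
maximal admissible [M] with its multipliers. *)
Lemma chevalley : exists O M,
  [/\ valuation_ring O, is_proper_ideal O M, B `<=` O & I `<=` M].
Proof.
have [M aM Mmax] := maximal_admissible_exists.
exists (multipliers M), M; split.
- exact: multipliers_valuation_ring.
- exact: maximal_admissible_ideal.
- by move=> b Bb m Mm; apply: (admZ aM).
- exact: adm_sub aM.
Qed.

End Extension.
End Chevalley.

(** * Ordered groups and values of powers *)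

Section DivisibleOrderedGroup.
Variable G : divOrderedGroupType.

Lemma omulrn_ge0 (g : G) n : (0 < n)%N -> (0 <= g *+ n) = (0 <= g).
Proof.
move=> n0; have pos (h : G) k : 0 <= h -> 0 <= h *+ k.
  by move=> h0; elim: k => [|k IH]; rewrite ?mulr0n // mulrS -[0]addr0 oleD.
apply/idP/idP; last exact: pos.
case: n n0 => // n _; apply: contraTT; rewrite -!oltNge => g0.
rewrite mulrS -[0]addr0 Defs.ltr_leD //.
have : 0 <= - g *+ n by apply: pos; rewrite -(oleD2r g) add0r addNr ltW.
by rewrite mulNrn -(oleD2r (g *+ n) 0) add0r addNr.
Qed.

End DivisibleOrderedGroup.

Section ValuationPowers.
Variables (G : divOrderedGroupType) (R : comNzRingType) (nu : valuation G R).

Lemma valX a g n : nu a = fin g -> nu (a ^+ n) = fin (g *+ n).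
Proof.
move=> ag; elim: n => [|n IH]; first by rewrite expr0 Defs.val1 mulr0n.
by rewrite exprS Defs.valM ag IH oo_addfin mulrS.
Qed.

Lemma val_gtX a g n :
  (0 < n)%N -> fin g < nu a -> fin (g *+ n) < nu (a ^+ n).
Proof.
move=> + ga; case: n => // n _; elim: n => [|n IH]; first by rewrite mulr1n expr1.
by rewrite mulrS exprS Defs.valM; apply: oo_lt_leD => //; apply: ltW.
Qed.

End ValuationPowers.

Lemma val_field_finite (G : divOrderedGroupType) (K : fieldType) (nu : valuation G K) c :
  c != 0 -> exists2 g, nu c = fin g & nu c^-1 = fin (- g).
Proof.
move=> c0; have := Defs.valM nu c c^-1; rewrite mulfV // Defs.val1.
case: (nu c) (nu c^-1) => [g|] [h|] //=; rewrite oo_addfin => -[/esym/eqP].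
by rewrite addrC addr_eq0 => /eqP ->; exists g.
Qed.

(** * Extending a valuation along an algebraic extension *)

Section ExtendValuation.
Local Open Scope classical_set_scope.
Variables (G : divOrderedGroupType) (K : fieldType) (nu0 : valuation G K).
Variables (L : fieldExtType K) (O : set L).
Hypotheses (vO : valuation_ring O) (OK : forall c : K, O c%:A <-> fin 0 <= nu0 c).

Lemma vring_div_total a b : O (a / b) \/ O (b / a).
Proof. by rewrite -[b / a]invf_div; apply: (vring_total vO). Qed.

Lemma vring_div_trans a b c : b != 0 -> O (a / b) -> O (b / c) -> O (a / c).
Proof.
by move=> b0 ab bc; rewrite -(divfK b0 a) -[X in O X]mulrA; apply: (subringM vO).
Qed.

(** A valuation ring is integrally closed; only roots of its elements are
needed. *)
Lemma vring_root x n : (0 < n)%N -> O (x ^+ n) -> O x.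
Proof.
move=> n0 Oxn; have [//|OV] := vring_total vO x.
have [->|x0] := eqVneq x 0; first exact: (subring0 vO).
rewrite -[x]mulr1 -(mulfV (expf_neq0 n.-1 x0)) mulrA -exprS prednK //.
by rewrite -exprVn; apply: (subringM vO) => //; apply: (subringX _ vO).
Qed.

(** The nonzero terms of a vanishing sum cannot all have distinct values: otherwise the term
[t i] of least value would be a sum of terms of larger value. *)
Lemma associated_terms (I : finType) (t : I -> L) i0 :
  t i0 != 0 -> \sum_i t i = 0 ->
  exists i j, [/\ i != j, t i != 0, t j != 0, O (t i / t j) & O (t j / t i)].
Proof.
move=> ti0 sum0.
pose ord : rel L := fun a b => `[< O (b / a) >].
have [||||i ti mini] := @extremum_inP _ _ ord i0 (fun i => t i != 0) t.
- by move=> i ti; apply/asboolP; rewrite divff //; apply: subring1 vO.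
- move=> j i k tj _ _ /asboolP ij /asboolP jk; apply/asboolP.
  exact: vring_div_trans tj jk ij.
- by move=> i j _ _; apply/orP; case: (vring_div_total (t i) (t j)) => h;
    [right|left]; apply/asboolP.
- by [].
exists i; apply: contrapT => none.
(* The elements of value larger than [t i]. *)
pose N : set L := [set b | ~ (b != 0 /\ O (t i / b))].
have ND b c : N b -> N c -> N (b + c).
  wlog Ocb : b c / O (c / b).
    move=> H Nb Nc; have [h|h] := vring_div_total c b; first exact: H.
    by rewrite addrC; apply: H.
  have [->|b0] := eqVneq b 0; first by rewrite add0r.
  move=> Nb _ [bc0 Obc]; apply: Nb; split=> //.
  apply: vring_div_trans bc0 Obc _; rewrite mulrDl divff //.
  by apply: (subringD vO) => //; apply: subring1 vO.
have NN b : N (- b) -> N b.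
  move=> Nb [b0 Ob]; apply: Nb; rewrite oppr_eq0; split=> //.
  by rewrite invrN mulrN; apply: (subringN vO).
have : N (t i).
  apply: NN; have <- : \sum_(j | j != i) t j = - t i.
    by apply: (addrI (t i)); rewrite subrr; apply: etrans sum0; rewrite [RHS](bigD1 i).
  apply: (big_ind N) => // [|j ji]; first by case; rewrite eqxx.
  move=> [tj Otj]; apply: none; exists j; split=> //; first by rewrite eq_sym.
  exact/asboolP/mini.
by apply; split=> //; rewrite divff //; apply: subring1 vO.
Qed.

(** The value of [y] is the [n]-th part of [nu0 c] as soon as [y ^+ n] and [c]
differ by a unit of [O]. *)
Definition has_value (y : L) (g : G) := y != 0 /\ exists n c,
  [/\ (0 < n)%N, nu0 c = fin (g *+ n), O (y ^+ n / c%:A) & O (c%:A / y ^+ n)].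

(** Two terms of an algebraic equation of [y] over [K] are associated, so that a
power of [y] is associated to a quotient of coefficients; divisibility of [G]
then yields the value. *)
Lemma has_value_exists (y : L) : y != 0 -> exists g, has_value y g.
Proof.
move=> y0.
have [p [p0 py]] : exists p : {poly K}, p != 0 /\ (map_poly (in_alg L) p).[y] = 0.
  have /polyOver1P[p pE] := minPolyOver 1 y.
  exists p; split; last by rewrite -pE minPolyxx.
  by rewrite -(map_poly_eq0 (in_alg L)) -pE monic_neq0 // monic_minPoly.
pose t (i : 'I_(size p)) : L := p`_i *: y ^+ i.
have sum0 : \sum_i t i = 0.
  apply: etrans py; rewrite horner_coef size_map_poly; apply: eq_bigr => i _.
  by rewrite coef_map /= mulr_algl.
have lt : ((size p).-1 < size p)%N by rewrite prednK ?lt0n ?size_poly_eq0.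
have nzE i : (t i != 0) = (p`_i != 0) by rewrite scaler_eq0 negb_or expf_neq0 ?andbT.
have t0 : t (Ordinal lt) != 0 by rewrite nzE /= -lead_coefE lead_coef_eq0.
have [i [j []]] := associated_terms t0 sum0; rewrite !nzE.
wlog ij : i j / (i < j)%N.
  move=> H ij; have [ltij|ltji|/val_inj eij] := ltngtP i j.
  - exact: H.
  - by move=> ti tj O1 O2; apply: (H j i) => //; rewrite eq_sym.
  - by rewrite eij eqxx in ij.
move=> _ ai aj; rewrite /t.
have pijE : (p`_i / p`_j)%:A = (p`_i)%:A / (p`_j)%:A :> L by rewrite -!in_algE fmorph_div.
have E : p`_j *: y ^+ j / (p`_i *: y ^+ i) = y ^+ (j - i) / (p`_i / p`_j)%:A.
  rewrite -[in y ^+ j](subnK (ltnW ij)) exprD -[p`_j *: _]mulr_algl.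
  rewrite -[p`_i *: _]mulr_algl pijE; field.
  by rewrite !expf_neq0 // !scaler_eq0 !negb_or !oner_eq0 ai aj.
have [g nug _] := val_field_finite nu0 (mulf_neq0 ai (invr_neq0 aj)).
have ji0 : (0 < j - i)%N by rewrite ssrnat.subn_gt0.
have [h hg] := group_divisible (j - i)%N g ji0.
rewrite -[X in O X -> _]invf_div E invf_div => O1 O2.
exists h; split=> //; exists (j - i)%N, (p`_i / p`_j).
by rewrite ji0 nug hg.
Qed.

Lemma value_ge0P y g : has_value y g -> O y <-> 0 <= g.
Proof.
move=> [y0 [n [c [n0 cg O1 O2]]]].
have c0 : c%:A != 0 :> L.
  rewrite scaler_eq0 oner_eq0 orbF; apply/eqP => c0.
  by move: cg; rewrite c0 Defs.val0.
have yn0 := expf_neq0 n y0.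
rewrite -(omulrn_ge0 g n0) -(oo_le_fin 0) -cg -OK; split=> [Oy|Oc].
  by rewrite -[c%:A](divfK yn0); apply: (subringM vO) => //; apply: (subringX _ vO).
by apply: (vring_root n0); rewrite -(divfK c0 (y ^+ n)); apply: (subringM vO).
Qed.

Lemma has_valueM y z g h : has_value y g -> has_value z h -> has_value (y * z) (g + h).
Proof.
move=> [y0 [n [c [n0 cg O1 O2]]]] [z0 [m [d [m0 dh O3 O4]]]].
split; first exact: mulf_neq0.
exists (n * m)%N, (c ^+ m * d ^+ n); split.
- by rewrite muln_gt0 n0.
- by rewrite Defs.valM (valX m cg) (valX n dh) oo_addfin mulrnDl -!mulrnA [(m * n)%N]mulnC.
- have -> : (y * z) ^+ (n * m) / (c ^+ m * d ^+ n)%:A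
      = (y ^+ n / c%:A) ^+ m * (z ^+ m / d%:A) ^+ n :> L.
    rewrite exprMn exprM [(n * m)%N]mulnC exprM !expr_div_n mulf_div.
    by rewrite -!in_algE rmorphM !rmorphXn.
  by apply: (subringM vO); apply: (subringX _ vO).
- have -> : (c ^+ m * d ^+ n)%:A / (y * z) ^+ (n * m)
      = (c%:A / y ^+ n) ^+ m * (d%:A / z ^+ m) ^+ n :> L.
    rewrite exprMn exprM [(n * m)%N]mulnC exprM !expr_div_n mulf_div.
    by rewrite -!in_algE rmorphM !rmorphXn.
  by apply: (subringM vO); apply: (subringX _ vO).
Qed.

Lemma has_valueV y g : has_value y g -> has_value y^-1 (- g).
Proof.
move=> [y0 [n [c [n0 cg O1 O2]]]]; split; first exact: invr_neq0.
have c0 : c != 0 by apply/eqP => c0; move: cg; rewrite c0 Defs.val0.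
exists n, c^-1; split=> //.
- by have [h] := val_field_finite nu0 c0; rewrite cg => -[<-]; rewrite mulNrn.
- by rewrite -in_algE fmorphV exprVn invrK mulrC.
- by rewrite -in_algE fmorphV exprVn invrK mulrC.
Qed.

Lemma has_value_le y z g h : has_value y g -> has_value z h -> O (z / y) <-> g <= h.
Proof.
move=> yg zh; rewrite (value_ge0P (has_valueM zh (has_valueV yg))).
by rewrite -(oleD2r g 0) add0r subrK.
Qed.

Lemma has_value_uniq y g h : has_value y g -> has_value y h -> g = h.
Proof.
move=> yg yh; have Oyy : O (y / y) by rewrite divff ?yg.1 //; apply: subring1 vO.
by apply: le_anti; apply/andP; split; apply/(has_value_le _ _).1/Oyy.
Qed.

Lemma has_value_alg c g : nu0 c = fin g -> has_value c%:A g.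
Proof.
move=> cg; have c0 : c%:A != 0 :> L.
  rewrite scaler_eq0 oner_eq0 orbF; apply/eqP => c0.
  by move: cg; rewrite c0 Defs.val0.
split=> //; exists 1%N, c; rewrite mulr1n expr1 divff //.
by split=> //; apply: subring1 vO.
Qed.

Definition value_of (y : L) : Gamma_oo G :=
  if pselect (exists g, has_value y g) is left e then fin (sval (cid e)) else infty.

Lemma value_ofE y g : has_value y g -> value_of y = fin g.
Proof.
move=> yg; rewrite /value_of; case: pselect => [e|[]]; last by exists g.
by case: (cid e) => h yh /=; rewrite (has_value_uniq yh yg).
Qed.

Lemma value_of0 : value_of 0 = infty.
Proof.
by rewrite /value_of; case: pselect => // e; exfalso; case: e => g []; rewrite eqxx.
Qed.

Lemma value_ofM y z : value_of (y * z) = value_of y + value_of z.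
Proof.
have [->|y0] := eqVneq y 0; first by rewrite mul0r value_of0.
have [->|z0] := eqVneq z 0; first by rewrite mulr0 value_of0 oo_addinfty.
have [g yg] := has_value_exists y0; have [h zh] := has_value_exists z0.
by rewrite (value_ofE yg) (value_ofE zh) (value_ofE (has_valueM yg zh)).
Qed.

Lemma value_ofD y z : Order.min (value_of y) (value_of z) <= value_of (y + z).
Proof.
have [->|y0] := eqVneq y 0; first by rewrite add0r ge_min lexx orbT.
have [->|z0] := eqVneq z 0; first by rewrite addr0 ge_min lexx.
have [->|yz0] := eqVneq (y + z) 0; first by rewrite value_of0 oo_le_infty.
have [g yg] := has_value_exists y0; have [h zh] := has_value_exists z0.
have [k yzk] := has_value_exists yz0.
rewrite (value_ofE yg) (value_ofE zh) (value_ofE yzk) ge_min !oo_le_fin.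
apply/orP; case: (vring_div_total y z) => Oyz; [right|left].
  apply/(has_value_le zh yzk); rewrite mulrDl divff //.
  by apply: (subringD vO) => //; apply: subring1 vO.
apply/(has_value_le yg yzk); rewrite mulrDl divff //.
by apply: (subringD vO) => //; apply: subring1 vO.
Qed.

Lemma value_of_alg c : value_of c%:A = nu0 c.
Proof.
have [->|c0] := eqVneq c 0; first by rewrite scale0r value_of0 Defs.val0.
by have [g cg _] := val_field_finite nu0 c0; rewrite cg (value_ofE (has_value_alg cg)).
Qed.

Lemma value_of1 : value_of 1 = fin 0.
Proof. by rewrite -(scale1r 1) value_of_alg Defs.val1. Qed.

(** The last clause records that the value group of [w] is torsion modulo that of
[nu0]. *)
Lemma extend_valuation : exists w : valuation G L,
  [/\ forall c : K, w c%:A = nu0 c, forall y, O y <-> fin 0 <= w y &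
    forall y, y != 0 -> exists n c, [/\ (0 < n)%N, c != 0 & w (y ^+ n) = nu0 c]].
Proof.
exists (Valuation value_ofM value_ofD value_of1 value_of0); split=> [||y y0] /=.
- exact: value_of_alg.
- move=> y; have [->|y0] := eqVneq y 0.
    by rewrite value_of0 oo_le_infty; split=> // _; apply: (subring0 vO).
  by have [g yg] := has_value_exists y0; rewrite (value_ofE yg); apply: value_ge0P.
have [g yg] := has_value_exists y0; have [_ [n [c [n0 cg _ _]]]] := yg.
exists n, c; split=> //; first by apply/eqP => c0; move: cg; rewrite c0 Defs.val0.
have := @valX _ _ (Valuation value_ofM value_ofD value_of1 value_of0) y g n.
by move=> /= ->; rewrite ?cg ?(value_ofE yg).
Qed.

End ExtendValuation.

(** * Units among initial forms *)

Section InitialUnit.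
Variables (G : divOrderedGroupType) (R : comNzRingType) (nu : valuation G R).

Lemma coef_mul_hom (y : graded_ring nu) d r g :
  (y * gr_hom nu d r) (g + d) = piece_mul (g + d) (y g) (cls nu d r).
Proof.
rewrite [LHS](@gr_mulE _ _ _ (undup (g :: gr_supp y)) [:: d]) ?undup_uniq //; first last.
- move=> h; rewrite gr_suppP /= /gr_hom_coef inE.
  by case: (eqVneq h d) => // _; rewrite eqxx.
- by move=> h hy; rewrite mem_undup inE hy orbT.
under eq_bigr do rewrite big_mkcond big_seq1 (inj_eq (addIr d)).
rewrite -big_mkcond (@sum_only1 _ _ _ _ g) ?undup_uniq //.
  by rewrite /= /gr_hom_coef eqxx.
by rewrite mem_undup mem_head.
Qed.

Lemma gr_hom1E c : c = 0 -> (1 : graded_ring nu) c = cls nu c 1.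
Proof. by move=> c0; rewrite /= /gr_hom_coef c0 eqxx. Qed.

Lemma val_ideal_lt1 x y : nu x = infty -> ~ fin 0 < nu (y * x - 1).
Proof.
move=> x_oo y1; have yx : fin 0 < nu (y * x).
  by rewrite Defs.valM x_oo oo_addinfty oo_fin_infty.
by have := valB_gt yx y1; rewrite opprB addrC subrK Defs.val1 ltxx.
Qed.

(** If [y] inverts the initial form of [F], which has degree [nu F], then so does
the component of [y] in degree [- nu F], and the product of classes is [1] in
degree [0] exactly when [a * F - 1] has positive value. When [nu F] is infinite
both sides are false. *)
Lemma initial_unitP F :
  initial nu F \is a GRing.unit <-> exists a, fin 0 < nu (a * F - 1).
Proof.
case Fd: (nu F) => [d|]; rewrite /initial Fd; last first.
  by split=> [|[a /val_ideal_lt1]]; [rewrite unitr0 | case].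
have dF : fin d <= nu F by rewrite Fd.
split=> [/unitrPr[y]|[a]].
  rewrite mulrC => /(congr1 (fun x : graded_ring nu => x (- d + d))).
  rewrite coef_mul_hom (gr_hom1E (addNr d)) -{1}(repK (y (- d))).
  rewrite piece_mul_cls ?rep_ge // => /cls_eqP; rewrite addNr => H.
  exists (rep (y (- d))); apply: H; last by rewrite Defs.val1.
  by rewrite Defs.valM Fd -(addNr d) -(oo_addfin (- d)); apply: oo_leD; rewrite ?rep_ge.
move=> a0; have aF0 : nu (a * F) = fin 0.
  apply: le_anti; apply/andP; split; last first.
    rewrite -[a * F](subrK 1); apply: le_trans (Defs.valD nu _ _).
    by rewrite le_min Defs.val1 lexx ltW.
  rewrite leNgt; apply/negP => aFpos.
  have := valB_gt aFpos a0; rewrite opprB addrC subrK Defs.val1.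
  by rewrite ltxx.
have ae : nu a = fin (- d).
  move: aF0; rewrite Defs.valM Fd; case: (nu a) => //= e; rewrite oo_addfin.
  by move=> -[/eqP]; rewrite addr_eq0 => /eqP ->.
apply/unitrPr; exists (gr_hom nu (- d) a); rewrite mulrC.
apply: gr_eqP => c; rewrite -[c](subrK d) coef_mul_hom /= /gr_hom_coef.
rewrite -[_ - d == - d](inj_eq (addIr d)) addNr.
case: eqP => [c0|_]; last by rewrite piece_mul0l.
have -> : c - d = - d by apply: (addIr d); rewrite c0 addNr.
rewrite piece_mul_cls ?ae ?Fd //; apply/cls_eqP; rewrite addNr ?aF0 ?Defs.val1 //.
Qed.

End InitialUnit.

(** * Specialization to a root *)

Section Residue.
Variables (K : fieldType) (F : {poly K}) (F_irr : irreducible_poly F).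
Variables (L : fieldExtType K) (alpha : L).
Hypothesis Falpha : root (map_poly (in_alg L) F) alpha.

Lemma horner_alg_eq0 f : (horner_alg alpha f == 0) = (F %| f).
Proof.
apply/idP/idP => [f0|/dvdpP[q ->]]; last first.
  by rewrite rmorphM [X in _ * X](rootP Falpha) mulr0.
case: (boolP (coprimep F f)) => [|ncop]; last first.
  have := F_irr.2 _ _ (dvdp_gcdl F f); rewrite -coprimep_def => /(_ ncop) e.
  by rewrite -(eqp_dvdl _ e) dvdp_gcdr.
rewrite -(coprimep_map (in_alg L)) => /coprimep_root/(_ Falpha).
by rewrite -[_.[_]]/(horner_alg alpha f) f0.
Qed.

End Residue.

Section Pullback.
Variables (G : divOrderedGroupType) (R S : comNzRingType).
Variables (phi : {rmorphism R -> S}) (w : valuation G S).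

Fact pullback_valM a b : w (phi (a * b)) = w (phi a) + w (phi b).
Proof. by rewrite rmorphM Defs.valM. Qed.

Fact pullback_valD a b : Order.min (w (phi a)) (w (phi b)) <= w (phi (a + b)).
Proof. by rewrite rmorphD Defs.valD. Qed.

Fact pullback_val1 : w (phi 1) = fin 0.
Proof. by rewrite rmorph1 Defs.val1. Qed.

Fact pullback_val0 : w (phi 0) = infty.
Proof. by rewrite rmorph0 Defs.val0. Qed.

Definition pullback : valuation G R :=
  Valuation pullback_valM pullback_valD pullback_val1 pullback_val0.

End Pullback.

Section Specialization.
Local Open Scope classical_set_scope.
Variables (G : divOrderedGroupType) (K : fieldType) (nu0 : valuation G K).
Variables (nu : ext_valuation nu0) (F : {poly K}).
Hypotheses (F_irr : irreducible_poly F)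
  (F_nonunit : ~ exists a, fin 0 < nu (a * F - 1)).

Section Root.
Variables (L : fieldExtType K) (alpha : L).
Hypothesis Falpha : root (map_poly (in_alg L) F) alpha.
Let ev : {rmorphism {poly K} -> L} := horner_alg alpha.

Definition image_ge0 : set L := [set ev f | f in [set f | fin 0 <= nu f]].
Definition image_gt0 : set L := [set ev f | f in [set f | fin 0 < nu f]].

Lemma image_ge0_subring : is_subring image_ge0.
Proof.
split; first by exists 1; rewrite /= ?Defs.val1 // rmorph1.
- move=> _ _ [f f0 <-] [g g0 <-]; exists (f - g); last by rewrite rmorphB.
  exact: valB_ge.
- move=> _ _ [f f0 <-] [g g0 <-]; exists (f * g); last by rewrite rmorphM.
  by rewrite /= Defs.valM -[0]addr0 -(oo_addfin 0); apply: oo_leD.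
Qed.

(** Properness is where the hypothesis on [F] enters: [f alpha = 1] means that
[1 - f] is a multiple [a * F]. *)
Lemma image_gt0_ideal : is_proper_ideal image_ge0 image_gt0.
Proof.
split.
- by move=> _ [f f0 <-]; exists f => //; apply: ltW.
- by exists 0; rewrite /= ?Defs.val0 ?oo_fin_infty // rmorph0.
- move=> _ _ [f f0 <-] [g g0 <-]; exists (f + g); last by rewrite rmorphD.
  by apply: lt_le_trans (Defs.valD nu f g); rewrite lt_min f0.
- move=> _ _ [f f0 <-] [g g0 <-]; exists (f * g); last by rewrite rmorphM.
  by rewrite /= Defs.valM addrC -[0]addr0; apply: oo_lt_leD.
move=> [f f0 evf]; apply: F_nonunit.
have : F %| 1 - f.
  by rewrite -(horner_alg_eq0 F_irr Falpha) rmorphB rmorph1 evf subrr.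
move=> /dvdpP[a aF]; exists a; rewrite -aF addrAC subrr add0r.
by rewrite valN.
Qed.

(** The ring given by Chevalley's theorem meets [K] in the valuation ring of
[nu0], because the inverse of an element of negative value is in the ideal; so
it defines a valuation [w] extending [nu0]. *)
Lemma specialization_at_root : exists w : valuation G L,
  (forall c : K, w c%:A = nu0 c) /\ (forall f, nu f <= w (ev f)).
Proof.
have [O [M [vO idM BO IM]]] := chevalley image_ge0_subring image_gt0_ideal.
have evC c : ev c%:P = c%:A by apply: horner_algC.
have OK c : O c%:A <-> fin 0 <= nu0 c.
  split=> [Oc|c0]; last by apply: BO; exists c%:P; rewrite ?evC //= ext_valC.
  rewrite leNgt; apply/negP => c_lt0.
  have c0 : c != 0 by apply/eqP => c0; move: c_lt0; rewrite c0 Defs.val0.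
  have [g cg cVg] := val_field_finite nu0 c0.
  apply: (ideal1 idM); have <- : c%:A * (c^-1)%:A = 1 :> L.
    by rewrite -!in_algE -rmorphM mulfV // rmorph1.
  apply: (idealM idM) Oc _; apply: IM; exists (c^-1)%:P; rewrite ?evC //=.
  rewrite ext_valC cVg oo_lt_fin -(oltD2r g) addNr add0r.
  by move: c_lt0; rewrite cg oo_lt_fin.
have [w [wK wO wtor]] := extend_valuation vO OK.
(* If [f alpha] had too small a value, some [f ^+ n / c] of positive value would
   evaluate to a unit of [O] lying in the proper ideal [M]. *)
exists w; split=> // f; rewrite leNgt; apply/negP => wf.
have evf0 : ev f != 0.
  by apply: contraTneq wf => ->; rewrite Defs.val0 -leNgt oo_le_infty.
have [h wfh _] := val_field_finite w evf0.
have [n [c [n0 c0 wfn]]] := wtor _ evf0.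
have [g cg cVg] := val_field_finite nu0 c0.
have hg : h *+ n = g by move: wfn; rewrite (valX n wfh) cg => -[].
pose q := f ^+ n * (c^-1)%:P.
have Mq : M (ev q).
  apply: IM; exists q => //; rewrite /= Defs.valM ext_valC cVg -(subrr g) -{1}hg.
  by apply: oo_lt_leD => //; apply: val_gtX; rewrite -?wfh.
have wq : w (ev q) = fin 0.
  by rewrite rmorphM rmorphXn Defs.valM evC wK cVg wfn cg oo_addfin subrr.
have evq0 : ev q != 0.
  by apply/eqP => q0; move: wq; rewrite q0 Defs.val0.
apply: (ideal1 idM); rewrite -(mulVf evq0); apply: (idealM idM) Mq.
have [k wqk wqVk] := val_field_finite w evq0.
by apply/wO; rewrite wqVk; move: wqk; rewrite wq => -[<-]; rewrite oppr0.
Qed.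

End Root.

Lemma specialization : exists2 mu : ext_valuation nu0,
  supp mu = range (fun a => a * F) & forall f, nu f <= mu f.
Proof.
have [L _ [alpha Falpha _]] := irredp_FAdjoin F_irr.
have [w [wK nuw]] := specialization_at_root Falpha.
have wC c : pullback (horner_alg alpha) w c%:P = nu0 c.
  by rewrite /= horner_algC wK.
exists (ExtValuation wC) => //; apply/seteqP; split=> [f /= wf | _ [a _ <-]].
  have : F %| f.
    rewrite -(horner_alg_eq0 F_irr Falpha); apply/negPn/negP => /(val_field_finite w).
    by move=> [g]; rewrite -[w _]/(pullback (horner_alg alpha) w f) wf.
  by move=> /dvdpP[a ->]; exists a.
rewrite /supp /=; suff -> : horner_alg alpha (a * F) = 0 by rewrite Defs.val0.
by apply/eqP; rewrite (horner_alg_eq0 F_irr Falpha) dvdp_mull.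
Qed.

End Specialization.

(** * Valuations below those supported at an irreducible polynomial *)

Theorem theorem1p1 (G : divOrderedGroupType) (K : fieldType)
    (nu0 : valuation G K) (F : {poly K}) (nu : ext_valuation nu0)
    (F_monic : F \is monic) (F_irr : irreducible_poly F)
    (nu_not_max : ~ is_maximal (Ext nu)) :
  V_below F (Ext nu) <-> initial nu F \isn't a GRing.unit.
Proof.
split=> [[_ [mu -> suppF]] /asboolP le|/negP nonunit].
  apply/negP => /initial_unitP[a aF1].
  have F_oo : mu F = infty.
    have : supp mu F by rewrite suppF; exists 1; rewrite ?mul1r.
    exact.
  exact: (val_ideal_lt1 F_oo (lt_le_trans aF1 (le _))).
have [mu suppF le] : exists2 mu : ext_valuation nu0,
    supp mu = range (fun a => a * F) & forall f, nu f <= mu f.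
  by apply: specialization => // /initial_unitP.
by exists (Ext mu); [exists mu | apply/asboolP].
Qed.
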